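(* Let $M$ be a doxastic Kripke model and let $w$ be a world in $M$. (1) If $M\in\mathcal{K}_n^{te}$ (i.e. $M$ is local, proper, transitive and Euclidean), then for all $\varphi\in\mathcal{L}_B$: $M,w\models_{K}\varphi$ if and only if $\mathfrak{H}(M),E_w\models_{H}\varphi$. (2) If $M\in\mathcal{K}_n^{ste}$ (i.e. $M$ is local, proper, serial, transitive and Euclidean), then for all $\varphi\in\mathcal{L}_B^K$: $M,w\models_{K}\varphi$ if and only if $\mathfrak{H}(M),E_w\models_{H}\varphi$. Here $\mathfrak{H}(M)$ is the hypergraph model associated with $M$ and $E_w$ is its hyperedge corresponding to $w$.
   Context: Fix a set $\mathcal{A}$ of $n\geq 1$ agents (finite, $|\mathcal{A}|=n$). Each $a\in\mathcal{A}$ has a countable set $\mathsf{Var}_a$ of propositional letters; these sets are pairwise disjoint, and $\mathsf{Var}:=\bigcup_{a\in\mathcal{A}}\mathsf{Var}_a$. The language $\mathcal{L}_B^K$ is generated by $\varphi::=p\mid\neg\varphi\mid\varphi\wedge\varphi\mid B_a\varphi\mid K_a\varphi$ ($p\in\mathsf{Var}$, $a\in\mathcal{A}$); $\mathcal{L}_B$ is its fragment without the operators $K_a$. Kripke models. A doxastic Kripke model is a triple $M=(W,R,V)$ with $W\neq\emptyset$ a set, $R$ assigning to each $a\in\mathcal{A}$ a relation $R_a\subseteq W\times W$, and $V:W\to\mathcal{P}(\mathsf{Var})$. It is serial/transitive/Euclidean if every $R_a$ is (Euclidean: $uR_av$ and $uR_aw$ imply $vR_aw$). For a relation $S$, $S^{\leftrightarrow}:=S\cup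 S^{-1}$ and $S^{\equiv}$ is the smallest equivalence relation containing $S$. $M$ is proper if for all $u\neq v$ in $W$ there is $a\in\mathcal{A}$ with $(u,v)\notin R_a^{\equiv}$. $M$ is local if for all $a\in\mathcal{A}$, $u,v\in W$: $(u,v)\in R_a^{\leftrightarrow}$ implies $V(u)\cap\mathsf{Var}_a=V(v)\cap\mathsf{Var}_a$. Satisfaction: $M,w\models_Kp$ iff $p\in V(w)$; $\neg,\wedge$ as usual; $M,w\models_KB_a\varphi$ iff $M,u\models_K\varphi$ for all $u$ with $wR_au$; $M,w\models_KK_a\varphi$ iff $M,u\models_K\varphi$ for all $u$ with $wR_a^{\equiv}u$. Hypergraph models. A directed hyperedge over a set $\mathscr{V}$ is a pair $E=(X,Y)$ of finite disjoint (possibly empty) subsets of $\mathscr{V}$; $T(E):=X$, $H(E):=Y$, $U(E):=T(E)\cup H(E)$. A directed hypergraph is a pair $G=(\mathscr{V}(G),\mathscr{E}(G))$ with $\mathscr{V}(G)$ a non-empty set and $\mathscr{E}(G)$ a set of directed hyperedges over it. A coloring of $G$ is a map $\chi:\mathscr{V}(G)\to\mathcal{A}$ such that distinct vertices in $U(E)$ have distinct colors, for every $E\in\mathscr{E}(G)$. A hypergraph model is a triple $N=(G,\chi,\ell)$ with $G$ a directed hypergraph, $\chi$ a coloring of $G$, and $\ell:\mathscr{V}(G)\to\mathcal{P}(\mathsf{Var})$ such that $\chi(u)=a$ implies $\ell(u)\subseteq\mathsf{Var}_a$. Put $\ell(E):=\bigcup_{u\in U(E)}\ell(u)$. For $E_1,E_2\in\mathscr{E}(G)$: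 $E_1\vartriangleright_aE_2$ iff some $u\in U(E_1)\cap T(E_2)$ has $\chi(u)=a$; $E_1\approx_aE_2$ iff some $u\in U(E_1)\cap U(E_2)$ has $\chi(u)=a$. Satisfaction: $N,E\models_Hp$ iff $p\in\ell(E)$; $\neg,\wedge$ as usual; $N,E\models_HB_a\varphi$ iff $N,E'\models_H\varphi$ for all $E'\in\mathscr{E}(G)$ with $E\vartriangleright_aE'$; $N,E\models_HK_a\varphi$ iff $N,E'\models_H\varphi$ for all $E'\in\mathscr{E}(G)$ with $E\approx_aE'$. The model $\mathfrak{H}(M)$. Let $M=(W,R,V)$ be a local doxastic Kripke model. For each $(a,u)\in\mathcal{A}\times W$ let $x_u^a$ be a fresh element (distinct for distinct pairs), and let $[x_u^a]$ be its class under the equivalence relation $\{(x_u^a,x_v^a)\mid a\in\mathcal{A},(u,v)\in R_a^{\equiv}\}$. For $u\in W$ put $X_u:=\{[x_u^a]\mid a\in\mathcal{A},(u,u)\in R_a\}$, $Y_u:=\{[x_u^a]\mid a\in\mathcal{A},(u,u)\notin R_a\}$ and $E_u:=(X_u,Y_u)$. Then $\mathfrak{H}(M)=(G,\chi,\ell)$ with $\mathscr{V}(G)=\{[x_u^a]\mid a\in\mathcal{A},u\in W\}$, $\mathscr{E}(G)=\{E_u\mid u\in W\}$, $\chi([x_u^a]):=a$, and $\ell([x_u^a]):=V(u)\cap\mathsf{Var}_a$ (these are well defined). *)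

(* Defs.v *)
From mathcomp Require Import all_boot.
From mathcomp Require Import boolp classical_sets functions cardinality.
From Stdlib Require Import Relation_Operators.

Set Implicit Arguments.
Unset Strict Implicit.
Unset Printing Implicit Defensive.

Local Open Scope classical_set_scope.

(* The pairwise disjoint countable sets of letters are given as a family of
   countable types; their union is the disjoint sum. *)
Definition letter (A : finType) (Var : A -> countType) : Type :=
  {a : A & Var a}.

Definition letters_of (A : finType) (Var : A -> countType) (a : A) :
  set (letter Var) := [set p | tag p = a].
Arguments letters_of {A} Var a.

Inductive form (A : finType) (Var : A -> countType) : Type :=
  | Letter of letter Var
  | Neg of form Var
  | And of form Var & form Var
  | Bel of A & form Var
  | Know of A & form Var.

Fixpoint K_free (A : finType) (Var : A -> countType) (phi : form Var) : Prop :=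
  match phi with
  | Letter _ => True
  | Neg psi => K_free psi
  | And psi1 psi2 => K_free psi1 /\ K_free psi2
  | Bel _ psi => K_free psi
  | Know _ _ => False
  end.

Definition sym_closure (W : Type) (S : W -> W -> Prop) : W -> W -> Prop :=
  fun u v => S u v \/ S v u.

Definition equiv_closure (W : Type) (S : W -> W -> Prop) : W -> W -> Prop :=
  clos_refl_sym_trans W S.

Record kripke (A : finType) (Var : A -> countType) : Type := Kripke {
  world : Type;
  world_nonempty : inhabited world;
  acc : A -> world -> world -> Prop;
  val_at : world -> set (letter Var) }.

Section KripkeModels.
Variables (A : finType) (Var : A -> countType) (M : kripke Var).
Implicit Types (u v w : world M).

Definition kripke_serial : Prop := forall a u, exists v, acc a u v.

Definition kripke_transitive : Prop :=
  forall a u v w, acc a u v -> acc a v w -> acc a u w.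

Definition kripke_euclidean : Prop :=
  forall a u v w, acc a u v -> acc a u w -> acc a v w.

Definition kripke_proper : Prop :=
  forall u v, u <> v -> exists a, ~ equiv_closure (acc a) u v.

Definition kripke_local : Prop :=
  forall a u v, sym_closure (acc a) u v ->
    val_at u `&` letters_of Var a = val_at v `&` letters_of Var a.

Definition Kte : Prop :=
  [/\ kripke_local, kripke_proper, kripke_transitive & kripke_euclidean].

Definition Kste : Prop :=
  [/\ kripke_local, kripke_proper, kripke_serial,
      kripke_transitive & kripke_euclidean].

Fixpoint satK w (phi : form Var) : Prop :=
  match phi with
  | Letter p => val_at w p
  | Neg psi => ~ satK w psi
  | And psi1 psi2 => satK w psi1 /\ satK w psi2
  | Bel a psi => forall u, acc a w u -> satK u psi
  | Know a psi => forall u, equiv_closure (acc a) w u -> satK u psi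
  end.

End KripkeModels.

Definition edge_tail (T : Type) (E : set T * set T) : set T := E.1.
Definition edge_head (T : Type) (E : set T * set T) : set T := E.2.
Definition edge_support (T : Type) (E : set T * set T) : set T :=
  edge_tail E `|` edge_head E.

Definition is_hyperedge (T : Type) (E : set T * set T) : Prop :=
  [/\ finite_set (edge_tail E), finite_set (edge_head E)
    & edge_tail E `&` edge_head E = set0].

Record hypergraph : Type := Hypergraph {
  vertex : Type;
  vertex_nonempty : inhabited vertex;
  edges : set (set vertex * set vertex);
  edgesP : forall E, edges E -> is_hyperedge E }.

Definition is_coloring (A : Type) (G : hypergraph) (chi : vertex G -> A) :
  Prop :=
  forall E, edges E ->
    forall u v, edge_support E u -> edge_support E v ->
      u <> v -> chi u <> chi v.

Record hmodel (A : finType) (Var : A -> countType) : Type := HModel {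
  hgraph :> hypergraph;
  color : vertex hgraph -> A;
  colorP : is_coloring color;
  label : vertex hgraph -> set (letter Var);
  labelP : forall u a, color u = a -> label u `<=` letters_of Var a }.

Section HypergraphSatisfaction.
Variables (A : finType) (Var : A -> countType) (N : hmodel Var).
Implicit Types E : set (vertex N) * set (vertex N).

Definition edge_label E : set (letter Var) :=
  \bigcup_(u in edge_support E) label u.

Definition edge_dir (a : A) E1 E2 : Prop :=
  exists u, [/\ edge_support E1 u, edge_tail E2 u & color u = a].

Definition edge_adj (a : A) E1 E2 : Prop :=
  exists u, [/\ edge_support E1 u, edge_support E2 u & color u = a].

(* Only meaningful at hyperedges E of N; the modalities range over the
   hyperedges of N only. *)
Fixpoint satH E (phi : form Var) : Prop :=
  match phi with
  | Letter p => edge_label E p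
  | Neg psi => ~ satH E psi
  | And psi1 psi2 => satH E psi1 /\ satH E psi2
  | Bel a psi => forall E', edges E' -> edge_dir a E E' -> satH E' psi
  | Know a psi => forall E', edges E' -> edge_adj a E E' -> satH E' psi
  end.

End HypergraphSatisfaction.

Section FrakH.
Variables (A : finType) (Var : A -> countType).
Hypothesis A_gt0 : 0 < #|A|.
Variable M : kripke Var.
Implicit Types (a : A) (u : world M).

(* The fresh element x_u^a is the pair (a, u). *)
Definition xrel (x y : A * world M) : Prop :=
  x.1 = y.1 /\ equiv_closure (acc x.1) x.2 y.2.

Definition xclass_set (x : A * world M) : set (A * world M) :=
  [set y | xrel x y].

Definition frakH_vertex : Type :=
  {c : set (A * world M) | range xclass_set c}.

Definition xclass a u : frakH_vertex :=
  exist _ (xclass_set (a, u)) (imageT xclass_set (a, u)).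

Definition frakH_tail u : set frakH_vertex :=
  [set xclass a u | a in [set a | acc a u u]].

Definition frakH_head u : set frakH_vertex :=
  [set xclass a u | a in [set a | ~ acc a u u]].

Definition frakH_edge u : set frakH_vertex * set frakH_vertex :=
  (frakH_tail u, frakH_head u).

(* Colors and labels are read off a chosen member of the class; frakH_colorE
   and frakH_labelE below show that the choice is irrelevant, the latter for
   local M. *)
Definition xrepr (c : frakH_vertex) : A * world M := sval (cid2 (svalP c)).

Definition frakH_color (c : frakH_vertex) : A := (xrepr c).1.

Definition frakH_label (c : frakH_vertex) : set (letter Var) :=
  val_at (xrepr c).2 `&` letters_of Var (xrepr c).1.

Lemma xreprP a u : xrel (xrepr (xclass a u)) (a, u).
Proof.
rewrite /xrepr; case: cid2 => x _ /= e.
have : xclass_set (a, u) (a, u) by split=> //; exact: rst_refl.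
by rewrite -e.
Qed.

Lemma frakH_colorE a u : frakH_color (xclass a u) = a.
Proof. by have [] := xreprP a u. Qed.

Lemma frakH_labelE a u : kripke_local M ->
  frakH_label (xclass a u) = val_at u `&` letters_of Var a.
Proof.
move=> locM; rewrite /frakH_label; case: (xreprP a u) => /= ->.
move: (xrepr _).2 => v; elim=> {u v} [u v uv|u|u v _ ->|u v w _ -> _ ->] //.
by apply: locM; left.
Qed.

Lemma frakH_vertex_nonempty : inhabited frakH_vertex.
Proof.
have [u] := world_nonempty M.
by have /card_gt0P[a _] := A_gt0; constructor; exact: (xclass a u).
Qed.

Lemma frakH_edgesP E : range frakH_edge E -> is_hyperedge E.
Proof.
case=> u _ <-; split; try by apply: finite_image; exact: finite_finset.
rewrite -subset0 => c [[a /= aT <-] [b /= bH]].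
move=> /(congr1 frakH_color); rewrite !frakH_colorE => ba.
by apply: bH; rewrite ba.
Qed.

Definition frakH_graph : hypergraph :=
  Hypergraph frakH_vertex_nonempty frakH_edgesP.

Lemma frakH_colorP : is_coloring (G := frakH_graph) frakH_color.
Proof.
have supp u c : edge_support (frakH_edge u) c -> exists a, c = xclass a u.
  by case=> -[a _ <-]; exists a.
move=> E [u _ <-] c d /supp[a ->] /supp[b ->].
by rewrite !frakH_colorE => neq ab; apply: neq; rewrite ab.
Qed.

Lemma frakH_labelP (c : frakH_vertex) a :
  frakH_color c = a -> frakH_label c `<=` letters_of Var a.
Proof. by move=> <- p []. Qed.

Definition frakH : hmodel Var :=
  @HModel A Var frakH_graph frakH_color frakH_colorP frakH_label frakH_labelP.

End FrakH.

(* Main.v *)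
Require Import Defs.
From mathcomp Require Import all_boot.
From mathcomp Require Import boolp classical_sets functions cardinality.
From Stdlib Require Import Relation_Operators.

(** In a transitive Euclidean model, worlds in the same [R_a]-equivalence class
    have the same [R_a]-successors. Hence [w R_a u] holds iff [w] and [u] share
    their [a]-colored vertex and [u R_a u], which says exactly that the
    [a]-vertex common to [E_w] and [E_u] lies in the tail of [E_u]. The
    correspondence between [R_a^≡] and sharing an [a]-colored vertex holds in
    every model. *)

Set Implicit Arguments.
Unset Strict Implicit.
Unset Printing Implicit Defensive.

Local Open Scope classical_set_scope.

Section KripkeFrames.
Variables (A : finType) (Var : A -> countType) (M : kripke Var).
Implicit Types (a : A) (u v w : world M).

(** On a generating step [acc a u v], Euclideanness moves successors from [u] to [v] and
    transitivity moves them back; an equivalence of successors then propagates through the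
    closure. *)
Lemma equiv_closure_acc a u v w :
  kripke_transitive M -> kripke_euclidean M ->
  equiv_closure (acc a) u v -> acc a u w <-> acc a v w.
Proof.
move=> tr eu uv; elim: uv w => {u v} [u v uv|u|u v _ IH|u v x _ IH1 _ IH2] w.
- by split; [exact: eu | exact: tr].
- by [].
- by rewrite IH.
- by rewrite IH1.
Qed.

Lemma acc_equiv_closure a u v :
  kripke_transitive M -> kripke_euclidean M ->
  acc a u v <-> equiv_closure (acc a) u v /\ acc a v v.
Proof.
move=> tr eu; split=> [uv|[uv vv]].
  (* Euclideanness applied to [uv] twice gives [acc a v v]. *)
  by split; [exact: rst_step | exact: (eu _ u)].
by apply/(equiv_closure_acc v tr eu uv).
Qed.

End KripkeFrames.

Section HyperedgeRelations.
Variables (A : finType) (Var : A -> countType) (A_gt0 : 0 < #|A|).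
Variable M : kripke Var.
Implicit Types (a b : A) (u v w : world M).

Lemma xclass_eq a u v :
  xclass a u = xclass a v <-> equiv_closure (acc a) u v.
Proof.
split=> [/(congr1 sval) /= e|uv].
  have : xclass_set (a, v) (a, v) by split=> //; exact: rst_refl.
  by rewrite -e => -[].
apply: eq_exist; apply/seteqP; split=> -[b z] [/= <- z_rel]; split=> //=.
  exact: rst_trans (rst_sym _ _ _ _ uv) z_rel.
exact: rst_trans uv z_rel.
Qed.

(** Tail and head sort the agents by whether [acc a u u] holds, so together they exhaust them. *)
Lemma frakH_supportP u (c : frakH_vertex M) :
  edge_support (frakH_edge u) c <-> exists a, c = xclass a u.
Proof.
split=> [[] [a _ <-]|[a ->]]; try by exists a.
by have [uu|uu] := pselect (acc a u u); [left | right]; exists a.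
Qed.

Lemma frakH_adj a u v :
  edge_adj (N := frakH A_gt0 M) a (frakH_edge u) (frakH_edge v) <->
  equiv_closure (acc a) u v.
Proof.
split=> [[c [/frakH_supportP[b cu] /frakH_supportP[d cv] /= ca]]|uv].
  have ba : b = a by rewrite -ca cu frakH_colorE.
  have da : d = a by rewrite -ca cv frakH_colorE.
  by apply/xclass_eq; rewrite -[in LHS]ba -cu cv da.
exists (xclass a u); split; last exact: frakH_colorE.
  by apply/frakH_supportP; exists a.
by apply/frakH_supportP; exists a; apply/xclass_eq.
Qed.

Lemma frakH_dir a u v :
  edge_dir (N := frakH A_gt0 M) a (frakH_edge u) (frakH_edge v) <->
  equiv_closure (acc a) u v /\ acc a v v.
Proof.
split=> [[c [cu cv ca]]|[uv vv]].
  split; first by apply/frakH_adj; exists c; split=> //; left.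
  (* The color of [c] identifies the agent [b] that put it in the tail as [a]. *)
  by case: cv ca => b vv <- /=; rewrite frakH_colorE => <-.
exists (xclass a v); split; last exact: frakH_colorE.
  by apply/frakH_supportP; exists a; apply/esym/xclass_eq.
by exists a.
Qed.

(** A letter has a single owner, so only the vertex of color [tag p] can carry it. *)
Lemma frakH_edge_label u (p : letter Var) : kripke_local M ->
  edge_label (N := frakH A_gt0 M) (frakH_edge u) p <-> val_at u p.
Proof.
move=> locM; split=> [[c /frakH_supportP[a ->]] /=|up].
  by rewrite frakH_labelE // => -[].
exists (xclass (tag p) u); first by apply/frakH_supportP; exists (tag p).
by rewrite /= frakH_labelE.
Qed.

(** Every hyperedge is some [frakH_edge u], so quantifying over hyperedges amounts to quantifying
    over worlds, and the modal cases reduce to [frakH_dir] and [frakH_adj]. *)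
Lemma satK_frakH (phi : form Var) w :
  kripke_local M -> kripke_transitive M -> kripke_euclidean M ->
  satK w phi <-> satH (N := frakH A_gt0 M) (frakH_edge w) phi.
Proof.
move=> locM tr eu.
elim: phi w => [p|psi IH|psi1 IH1 psi2 IH2|a psi IH|a psi IH] w /=.
- by rewrite frakH_edge_label.
- by rewrite IH.
- by rewrite IH1 IH2.
- split=> [H E' [u _ <-] /frakH_dir wu|H u wu].
    by apply/IH/H/acc_equiv_closure.
  by apply/IH/H; [exists u | apply/frakH_dir/acc_equiv_closure].
- split=> [H E' [u _ <-] /frakH_adj wu|H u wu]; first exact/IH/H.
  by apply/IH/H; [exists u | apply/frakH_adj].
Qed.

End HyperedgeRelations.

Theorem proposition4 (A : finType) (Var : A -> countType) (A_gt0 : 0 < #|A|)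
    (M : kripke Var) (w : world M) :
  (Kte M -> forall phi : form Var, K_free phi ->
     (satK w phi <-> satH (N := frakH A_gt0 M) (frakH_edge w) phi)) /\
  (Kste M -> forall phi : form Var,
     (satK w phi <-> satH (N := frakH A_gt0 M) (frakH_edge w) phi)).
Proof.
by split=> [[locM _ tr eu] phi _|[locM _ _ tr eu] phi]; apply: satK_frakH.
Qed.
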